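(* Let $\mathcal{N}=\mathbb{N}^{\mathbb{N}}$ be the Baire space and let $X=\{\alpha\in\mathcal{N} : \alpha(0)>0\}$. If $E\subseteq X\times X$ is an analytic ($\boldsymbol{\Sigma}^1_1$) equivalence relation on $X$, then there are equivalence relations $I$ and $J$ on $\mathcal{N}$ (i.e. $I,J\subseteq\mathcal{N}\times\mathcal{N}$), each of which has a closed graph in $\mathcal{N}\times\mathcal{N}$, such that $E=\operatorname{tc}(I\cup J)\cap(X\times X)$.
   Context: $\mathbb{N}=\{0,1,2,\dots\}$ and $\mathcal{N}=\mathbb{N}^{\mathbb{N}}$ carries the product topology of discrete spaces. For a relation $R\subseteq \Omega\times\Omega$, define $R^{(1)}=R$ and $R^{(n+1)}=R\circ R^{(n)}$ (composition of relations), and the transitive closure $\operatorname{tc}(R)=\bigcup_{n\ge 1}R^{(n)}$. A subset of $X\times X$ is analytic if it is analytic as a subset of $\mathcal{N}\times\mathcal{N}$ (equivalently, of the Polish space $X\times X$). *)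

(* Defs.v *)
From mathcomp Require Import all_boot all_classical all_analysis.

Set Implicit Arguments.
Unset Strict Implicit.
Unset Printing Implicit Defensive.

Local Open Scope classical_set_scope.
Local Open Scope relation_scope.

(* The topology on nat is the discrete one. *)
Definition baire : topologicalType := prod_topology (fun _ : nat => nat).

(* Boldface Sigma^1_1, for subsets of a Polish space: projection along the
   Baire space of a closed set. *)
Definition analytic (T : topologicalType) (A : set T) : Prop :=
  exists2 C : set (T * baire), closed C & A = fst @` C.

Definition equivalence_on (T : Type) (S : set T) (E : set (T * T)) : Prop :=
  [/\ E `<=` S `*` S,
      forall x, S x -> E (x, x),
      forall x y, E (x, y) -> E (y, x)
    & forall x y z, E (x, y) -> E (y, z) -> E (x, z)].

(* Indices are shifted by one: [rel_power R n] is R^(n+1), so that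
   [rel_power R 0] is R itself and not the identity. *)
Fixpoint rel_power (T : Type) (R : set (T * T)) (n : nat) : set (T * T) :=
  if n is m.+1 then R \; rel_power R m else R.

Definition tc (T : Type) (R : set (T * T)) : set (T * T) :=
  \bigcup_n rel_power R n.

Definition X : set baire := [set a : baire | 0 < a 0].

(* Main.v *)
Require Import Defs.
From mathcomp Require Import all_boot all_classical all_analysis.

Local Open Scope classical_set_scope.

(* A point a with a 0 = 0 encodes a triple of elements of the Baire space.
   Write E as the projection of a closed set C of triples (x, y, z), and let D be
   the closed set of points that lie in X or encode a triple in C.  Let p and q be
   the continuous maps that are the identity on X and send the code of (x, y, z)
   to x and to y, respectively.  Identifying points of D with the same image under
   p, respectively q, gives I and J.  If (x, y) is in E, with witness z, then the
   code of (x, y, z) is I-equivalent to x and J-equivalent to y.  Conversely,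
   p(a) E q(a) for all a in D, so that neither I nor J changes the E-class
   of p(a). *)

(** Neighbourhoods of [f u] and [g u] pull back to one of [u], which meets the set, so they
    intersect. *)
Lemma closed_eq_fun (S T : topologicalType) (f g : S -> T) :
  hausdorff_space T -> continuous f -> continuous g ->
  closed [set u | f u = g u].
Proof.
move=> hT cf cg u clu; apply: hT => A B fA gB.
have fA' : nbhs u (f @^-1` A) := cf u _ fA.
have gB' : nbhs u (g @^-1` B) := cg u _ gB.
have [v [/= fgv [vA vB]]] := clu _ (filterI fA' gB').
by exists (f v); split=> //; rewrite fgv.
Qed.

Lemma baire_hausdorff : hausdorff_space baire.
Proof. by apply: hausdorff_product => _; exact: discrete_hausdorff. Qed.

Lemma continuous_baire (S : topologicalType) (f : S -> baire) :
  (forall n, continuous (fun a => f a n)) -> continuous f.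
Proof.
by move=> fn a; apply/cvg_sup => n; exact/continuous_comp_initial/fn.
Qed.

Lemma baire_proj_continuous (n : nat) : continuous (fun a : baire => a n).
Proof. exact: (@proj_continuous nat (fun=> nat)). Qed.

Lemma closed_X : closed X.
Proof.
have /continuous_closedP := baire_proj_continuous 0.
by move/(_ [set m : nat | 0 < m]); apply; exact: discrete_closed.
Qed.

(** Three sequences are interleaved by residue modulo 3; the shift by one keeps [a 0] free as the
    tag. *)
Definition component (k : nat) (a : baire) : baire := fun n => a (n * 3 + k).+1.

Definition code (x y z : baire) : baire := fun m =>
  if m is m'.+1 then nth x [:: x; y; z] (m' %% 3) (m' %/ 3) else 0.

Lemma component_code k x y z :
  k < 3 -> component k (code x y z) = nth x [:: x; y; z] k.
Proof.
move=> k3; apply: funext => n; rewrite /component /code.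
by rewrite modnMDl divnMDl// modn_small// divn_small// addn0.
Qed.

Lemma component_continuous k : continuous (component k).
Proof. by apply: continuous_baire => n; exact: baire_proj_continuous. Qed.

Definition decode (a : baire) : baire * baire * baire :=
  (component 0 a, component 1 a, component 2 a).

Lemma decode_code x y z : decode (code x y z) = (x, y, z).
Proof. by rewrite /decode !component_code. Qed.

Lemma decode_continuous : continuous decode.
Proof.
move=> a; have ck k := component_continuous k a.
exact: cvg_pair (cvg_pair (ck 0) (ck 1)) (ck 2).
Qed.

Definition base (k : nat) (a : baire) : baire :=
  if 0 < a 0 then a else component k a.

Lemma base_X k {a} : X a -> base k a = a.
Proof. by rewrite /base => ->. Qed.

Lemma base_code k x y z :
  k < 3 -> base k (code x y z) = nth x [:: x; y; z] k.
Proof. exact: component_code. Qed.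

Lemma base_continuous k : continuous (base k).
Proof.
(* Coordinate [n] is locally constant: it depends only on the tag [a 0], on [a n] and on one
   coordinate of [component k a]. *)
apply: continuous_baire => n a; apply/discrete_cvg.
have near_proj m : \forall b \near a, b m = a m.
  exact: (baire_proj_continuous m _ _ (discrete_set1 (a m))).
have : \forall b \near a, base k b n = base k a n; last by [].
near=> b.
have b0 : b 0 = a 0 by near: b; exact: near_proj.
have bn : b n = a n by near: b; exact: near_proj.
have bk : component k b n = component k a n by near: b; exact: near_proj.
by rewrite /base b0; case: ifP.
Unshelve. all: by end_near. Qed.

Definition dom (C : set (baire * baire * baire)) : set baire :=
  X `|` decode @^-1` C.

Lemma closed_dom C : closed C -> closed (dom C).
Proof.
move=> cC; apply: closedU; first exact: closed_X.
by have /continuous_closedP := decode_continuous; exact.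
Qed.

(** The diagonal makes the relation reflexive off [D], where each point is its own class. *)
Definition kernel_on {T U : Type} (D : set T) (f : T -> U) : set (T * T) :=
  [set ab | ab.1 = ab.2] `|`
  (D `*` D) `&` [set ab | f ab.1 = f ab.2].

Lemma kernel_on_equivalence (T U : Type) (D : set T) (f : T -> U) :
  equivalence_on setT (kernel_on D f).
Proof.
split=> [//|x _|x y|x y z]; first by left.
  by case=> [/= ->|[[/= Dx Dy] fxy]]; [left|right; split].
case=> [/= ->//|[[/= Dx Dy] fxy]] [/= <-|[[/= _ Dz] fyz]]; right=> //.
by split=> //=; rewrite fxy.
Qed.

Lemma closed_kernel_on (S T : topologicalType) (D : set S) (f : S -> T) :
  hausdorff_space S -> hausdorff_space T -> closed D -> continuous f ->
  closed (kernel_on D f).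
Proof.
move=> hS hT cD cf.
have c1 : continuous (fst : S * S -> S) by move=> ?; exact: cvg_fst.
have c2 : continuous (snd : S * S -> S) by move=> ?; exact: cvg_snd.
apply: closedU; first exact: closed_eq_fun.
apply: closedI.
  by apply: closedI; [move/continuous_closedP: c1|move/continuous_closedP: c2];
    exact.
apply: closed_eq_fun => // ab; first exact: continuous_comp (c1 ab) (cf _).
exact: continuous_comp (c2 ab) (cf _).
Qed.

Lemma sub_tc {T : Type} {R : set (T * T)} : R `<=` tc R.
Proof. by move=> ab Rab; exists 0. Qed.

(** In [R \; rel_power R n] the power acts first, so chains grow at their end. *)
Lemma tc_step {T : Type} {R : set (T * T)} {x z : T} (y : T) :
  tc R (x, y) -> R (y, z) -> tc R (x, z).
Proof. by move=> [n _ Rxy] Ryz; exists n.+1; last exists y. Qed.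

Lemma tc_min {T : Type} {R S : set (T * T)} :
  R `<=` S -> (forall x y z, S (x, y) -> S (y, z) -> S (x, z)) ->
  tc R `<=` S.
Proof.
move=> RS trS ab [n _]; elim: n ab => [|n IHn] [a b]; first exact: RS.
by move=> [c /= /IHn Sac /RS Scb]; exact: trS Sac Scb.
Qed.

Theorem theorem1 (E : set (baire * baire)) :
  equivalence_on X E -> analytic E ->
  exists I J : set (baire * baire),
    [/\ equivalence_on [set: baire] I,
        equivalence_on [set: baire] J,
        closed I,
        closed J
      & E = tc (I `|` J) `&` (X `*` X)].
Proof.
move=> [EX Erefl Esym Etrans] [C cC EC].
have closedK k : closed (kernel_on (dom C) (base k)).
  apply: closed_kernel_on; [exact: baire_hausdorff..| |].
  - exact: closed_dom.
  - exact: base_continuous.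
exists (kernel_on (dom C) (base 0)), (kernel_on (dom C) (base 1)); split=> //.
- exact: kernel_on_equivalence.
- exact: kernel_on_equivalence.
have base01 a : dom C a -> E (base 0 a, base 1 a).
  have [Xa _|a0] := boolP (0 < a 0); first by rewrite !base_X//; exact: Erefl.
  case; first by rewrite /X /= (negbTE a0).
  by move=> Ca; rewrite /base (negbTE a0) EC; exists (decode a).
(* [E] is reflexive only on [X]; [base01] places [base 0 a] there. *)
have base00 a : dom C a -> E (base 0 a, base 0 a).
  by move=> /base01/EX[Xa _]; exact: Erefl.
apply/seteqP; split=> [[x y] Exy|[x y] [tcxy [/= Xx Xy]]].
  split; last exact: EX.
  have [Xx Xy] := EX _ Exy.
  move: Exy; rewrite EC => -[[[x' y'] z] Cw /= [xE yE]]; subst x' y'.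
  have domx : dom C x by left.
  have domy : dom C y by left.
  have domc : dom C (code x y z) by right; rewrite /= decode_code.
  apply: (tc_step (code x y z)).
    apply: sub_tc; left; right; split=> //.
    exact: etrans (base_X 0 Xx) (esym (base_code 0 x y z isT)).
  right; right; split=> //.
  exact: etrans (base_code 1 x y z isT) (esym (base_X 1 Xy)).
(* A transitive relation containing [I] and [J]. Equality covers points outside [dom C], whose
   [base 0] may lie outside [X]. *)
pose S : set (baire * baire) :=
  [set ab | ab.1 = ab.2 \/ E (base 0 ab.1, base 0 ab.2)].
suff : S (x, y).
  by case=> [/= ->|/=]; [exact: Erefl|rewrite !base_X].
apply: tc_min tcxy => [[a b]|a b c]; last first.
  by case=> [/= ->//|/= Eab] [/= <-|/= Ebc]; right=> //; exact: Etrans Eab Ebc.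
case=> -[/= ab|[[/= Da Db] fab]]; [by left| |by left|]; right=> /=.
  by rewrite -fab; exact: base00.
(* For [J], the chain is [base 0 a], [base 1 a] = [base 1 b], [base 0 b]. *)
apply: (Etrans _ _ _ (base01 _ Da)).
by rewrite fab; apply: Esym; exact: base01.
Qed.
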